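(* Consider the $N$-player oligopoly with deceptive players $z_1,\dots,z_n$ as described in the context. For every $\delta=[\delta_{z_1},\dots,\delta_{z_n}]^\top\in\mathbb{R}^n$, if $|\delta|<1$, then $\delta\in\Delta$; that is, the matrix $-K\overline{\mathcal{Q}}(\delta)$ is Hurwitz (all of its eigenvalues have negative real part).
   Context: Let $N\ge 2$, $[N]=\{1,\dots,N\}$, let $R_1,\dots,R_N>0$ be real numbers, and define $R_{\|}$ and $\overline{R}_i$ by $\frac{1}{R_{\|}}=\sum_{k=1}^N\frac1{R_k}$ and $\frac1{\overline{R}_i}=\sum_{k\neq i}\frac1{R_k}$. For real constants $S_d$, $m_1,\dots,m_N$, player $i$ in the oligopoly has cost $J_i(x)=-s_i(x)(x_i-m_i)$, $x\in\mathbb{R}^N$, with sales function $s_i(x)=\frac{R_{\|}}{R_i}\big(S_d-\frac{x_i}{\overline{R}_i}+\sum_{j\neq i}\frac{x_j}{R_j}\big)$. The (symmetric) Hessian $Q_i\in\mathbb{R}^{N\times N}$ of $J_i$ has entries $[Q_i]_{ii}=\frac{2R_{\|}}{R_i\overline{R}_i}$, $[Q_i]_{jk}=-\frac{R_{\|}}{R_jR_k}$ if $j\ne k$ and ($j=i$ or $k=i$), and $[Q_i]_{jk}=0$ otherwise. Let $\mathcal{Q}\in\mathbb{R}^{N\times N}$ be the matrix whose $i$-th row is the $i$-th row of $Q_i$, i.e. $[\mathcal{Q}]_{i:}=[Q_i]_{i:}$, where $[E]_{i:}$ denotes row $i$ of a matrix $E$. Deception structure: $\mathcal{D}=\{z_1,\dots,z_n\}\subset[N]$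 is the set of $n$ (distinct) deceptive players; each $i\in\mathcal{D}$ deceives a nonempty set of players $\mathcal{D}_i\subset[N]\setminus\{i\}$. For $j\in[N]$, $\mathcal{K}_j=\{i\in\mathcal{D}: j\in\mathcal{D}_i\}$ is the set of players deceiving player $j$. For $\delta=[\delta_{z_1},\dots,\delta_{z_n}]^\top\in\mathbb{R}^n$ define $\overline{\mathcal{Q}}(\delta)\in\mathbb{R}^{N\times N}$ by $[\overline{\mathcal{Q}}(\delta)]_{i:}=[\mathcal{Q}]_{i:}+\sum_{k\in\mathcal{K}_i}\delta_k[Q_i]_{k:}$ for $i\in[N]$. Let $K=\mathrm{diag}(k_1,\dots,k_N)$ with gains $k_i>0$. The stability-preserving set is $\Delta=\{\delta\in\mathbb{R}^n: -K\overline{\mathcal{Q}}(\delta)\text{ is Hurwitz}\}$. $|\cdot|$ is the Euclidean norm. *)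

(* Defs.v *)
From mathcomp Require Import all_boot all_order all_algebra.
From mathcomp Require Import reals topology normedtype derive.
From mathcomp Require Import complex.
From mathcomp Require Import ring.

Set Implicit Arguments.
Unset Strict Implicit.
Unset Printing Implicit Defensive.
Import Order.TTheory GRing.Theory Num.Theory numFieldNormedType.Exports.
Local Open Scope ring_scope.

(* The library norm on matrices is the sup norm, hence this definition. *)
Definition euclidean_norm (R : realType) n (v : 'cV[R]_n) : R :=
  Num.sqrt (\sum_(l < n) v l 0 ^+ 2).

(* The eigenvalues are the complex ones. *)
Definition hurwitz (R : realType) n (A : 'M[R]_n) : Prop :=
  forall lambda : R[i],
    eigenvalue (map_mx (real_complex R) A) lambda -> complex.Re lambda < 0.

Definition hessian (R : realType) N (f : 'rV[R]_N -> R) (x : 'rV[R]_N) :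
    'M[R]_N :=
  \matrix_(j, k) 'D_(delta_mx 0 j) ('D_(delta_mx 0 k) f) x.

Section Oligopoly.
Variables (R : realType) (N : nat).
(* Players are numbered from 0; r i is the resistance of player i. *)
Variables (r : 'I_N -> R) (Sd : R) (m : 'I_N -> R).

Definition Rpar : R := (\sum_k (r k)^-1)^-1.

Definition Rbar (i : 'I_N) : R := (\sum_(k | k != i) (r k)^-1)^-1.

Definition sales (i : 'I_N) (x : 'rV[R]_N) : R :=
  Rpar / r i * (Sd - x 0 i / Rbar i + \sum_(j | j != i) x 0 j / r j).

Definition cost (i : 'I_N) (x : 'rV[R]_N) : R :=
  - sales i x * (x 0 i - m i).

(* cost i is quadratic, so its Hessian does not depend on the point; its
   entries are computed in hessian_cost below. *)
Definition Qmat (i : 'I_N) : 'M[R]_N := hessian (cost i) 0.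

Definition calQ : 'M[R]_N := \matrix_i row i (Qmat i).

Section Deception.
(* z enumerates the deceptive players; D i is the set of players deceived by
   player i, and is relevant only for i in the range of z. *)
Variables (n : nat) (z : 'I_n -> 'I_N) (D : 'I_N -> {set 'I_N}).

Definition deceivers (j : 'I_N) : {set 'I_N} :=
  [set i in codom z | j \in D i].

(* The l-th coordinate of delta is the one attached to player z l. *)
Definition calQbar (delta : 'cV[R]_n) : 'M[R]_N :=
  \matrix_i (row i calQ +
    \sum_(l < n | z l \in deceivers i) delta l 0 *: row (z l) (Qmat i)).

Definition Delta (kappa : 'I_N -> R) (delta : 'cV[R]_n) : Prop :=
  hurwitz (- (diag_mx (\row_i kappa i) *m calQbar delta)).

End Deception.
End Oligopoly.

Local Open Scope classical_set_scope.

Lemma derive_quadratic (R : realType) N (f : 'rV[R]_N -> R) (x v : 'rV[R]_N)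
    (a b : R) :
  (forall h, f (h *: v + x) = f x + h * a + h ^+ 2 * b) -> 'D_v f x = a.
Proof.
move=> fE; apply/cvg_lim; first exact: norm_hausdorff.
have cvg_ab : (fun h : R => a + h * b) @ (0 : R)^' --> a.
  rewrite -[X in _ --> X]addr0 -[X in _ + X](mul0r b).
  apply: cvgD; first exact: cvg_cst.
  by apply: cvgMl; apply: cvg_within.
apply: cvg_trans cvg_ab; apply: near_eq_cvg; near=> h.
have h0 : h != 0 by near: h; exact: nbhs_dnbhs_neq.
by rewrite /= fE /GRing.scale /=; field.
Unshelve. all: by end_near.
Qed.

Lemma hessian_cost (R : realType) N (r : 'I_N -> R) (Sd : R) (m : 'I_N -> R)
    (i : 'I_N) (x : 'rV[R]_N) :
  hessian (cost r Sd m i) x =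
  \matrix_(j, k)
    if (j == i) && (k == i) then 2 * Rpar r / (r i * Rbar r i)
    else if (j == i) || (k == i) then - (Rpar r / (r j * r k))
    else 0.
Proof.
pose L (v : 'rV[R]_N) : R :=
  Rpar r / r i * (- (v 0 i / Rbar r i) + \sum_(j | j != i) v 0 j / r j).
have salesE h v y : sales r Sd i (h *: v + y) = sales r Sd i y + h * L v.
  rewrite /sales /L.
  have -> : \sum_(j | j != i) (h *: v + y) 0 j / r j =
      h * (\sum_(j | j != i) v 0 j / r j) + \sum_(j | j != i) y 0 j / r j.
    rewrite mulr_sumr -big_split; apply: eq_bigr => j _ /=.
    by rewrite !mxE mulrDl mulrA.
  by rewrite !mxE; ring.
have D1 v : 'D_v (cost r Sd m i) =
    fun y => - (sales r Sd i y * v 0 i + L v * (y 0 i - m i)).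
  apply: boolp.funext => y.
  apply: (@derive_quadratic _ _ _ _ _ _ (- (L v * v 0 i))) => h.
  by rewrite /cost salesE !mxE; ring.
have L_e j : L (delta_mx 0 j) =
    Rpar r / r i * (if j == i then - (Rbar r i)^-1 else (r j)^-1).
  rewrite /L; congr (_ * _); rewrite !mxE eqxx /= eq_sym.
  case: eqP => [->|/eqP ji].
    rewrite big1 ?addr0 ?mul1r // => k ki.
    by rewrite !mxE (negPf ki) mul0r.
  rewrite mul0r oppr0 add0r (bigD1 j) //= !mxE !eqxx mul1r big1 ?addr0 //.
  by move=> k /andP[_ kj]; rewrite !mxE (negPf kj) mul0r.
apply/matrixP => j k; rewrite !mxE D1.
rewrite (@derive_quadratic _ _ _ _ _
  (- (L (delta_mx 0 j) * (delta_mx 0 k : 'rV[R]_N) 0 i +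
      L (delta_mx 0 k) * (delta_mx 0 j : 'rV[R]_N) 0 i)) 0); last first.
  by move=> h; rewrite salesE !mxE; ring.
rewrite !L_e !mxE eqxx /= ![i == _]eq_sym !invfM.
by case: (eqVneq j i) => [->|ji]; case: (eqVneq k i) => [->|ki] /=; ring.
Qed.

(* Main.v *)
(** The Hessian [Q_i] has nonzero entries only in its [i]-th row and column, so
    deception perturbs only the diagonal of [calQ]. The [i]-th diagonal entry of
    [calQ] is twice the absolute sum of the other entries of its row, and for
    [|delta| < 1] the perturbation is smaller than that absolute sum. Hence
    [- K Qbar] has negative diagonal and is strictly diagonally dominant by
    rows; Gershgorin's theorem concludes. *)
Require Import Defs.
From mathcomp Require Import all_boot all_order all_algebra.
From mathcomp Require Import reals complex ring.
Local Open Scope ring_scope.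

Set Implicit Arguments.
Unset Strict Implicit.
Unset Printing Implicit Defensive.
Import Order.TTheory GRing.Theory Num.Theory.

(** [eigenvalue] refers to row eigenvectors, while Gershgorin discs by rows require column
    eigenvectors. *)
Lemma eigenvalue_trmx (F : fieldType) (n : nat) (A : 'M[F]_n) (a : F) :
  eigenvalue A^T a = eigenvalue A a.
Proof.
rewrite /eigenvalue /eigenspace.
have -> : A^T - a%:M = (A - a%:M)^T by rewrite linearB /= tr_scalar_mx.
by rewrite !kermx_eq0 !row_free_unit unitmx_tr.
Qed.

Lemma gershgorin (F : numFieldType) (n : nat) (A : 'M[F]_n) (a : F) :
  eigenvalue A a ->
  exists i, `|a - A i i| <= \sum_(j | j != i) `|A i j|.
Proof.
rewrite -eigenvalue_trmx => /eigenvalueP[u uA u0].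
have [i0 _ ui0] : exists2 i, true & u 0 i != 0.
  by have /rV0Pn[i ui] := u0; exists i.
(* The disc is that of a coordinate where the eigenvector has maximal modulus. *)
have [i _ imax] :=
  @real_arg_maxP F _ i0 xpredT (fun i => `|u 0 i|) isT (fun i _ => normr_real _).
exists i; have ui : 0 < `|u 0 i|.
  by apply: lt_le_trans (imax i0 isT); rewrite normr_gt0.
have ->: a - A i i = (\sum_(j | j != i) A i j * u 0 j) / u 0 i.
  have /matrixP/(_ 0 i) := uA; rewrite !mxE (bigD1 i) //= mxE => eq_i.
  have -> : \sum_(j | j != i) A i j * u 0 j = (a - A i i) * u 0 i.
    rewrite mulrBl -eq_i [A i i * _]mulrC addrAC subrr add0r.
    by apply: eq_bigr => j _; rewrite mxE mulrC.
  by rewrite mulfK // -normr_gt0.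
rewrite normrM normfV ler_pdivrMr // mulr_suml.
apply: le_trans (ler_norm_sum _ _ _) _; apply: ler_sum => j _.
by rewrite normrM ler_wpM2l //; exact: imax.
Qed.

(** Each Gershgorin disc has a negative real centre and a radius smaller than its distance to 0, so
    it lies in the open left half-plane. *)
Lemma hurwitz_diag_dominant (R : realType) (n : nat) (A : 'M[R]_n) :
  (forall i, \sum_(j | j != i) `|A i j| < - A i i) -> hurwitz A.
Proof.
move=> domA a /gershgorin[k]; rewrite mxE.
under eq_bigr => j _ do rewrite mxE normc_def /= expr0n addr0 sqrtr_sqr.
rewrite -rmorph_sum /= => le_a.
have := le_trans (normc_ge_Re _) le_a; rewrite lecR raddfB /= => /ler_normlW.
rewrite lerBlDr => /le_lt_trans; apply.
by rewrite -ltrBrDr sub0r.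
Qed.

Lemma norm_le_euclidean (R : realType) (n : nat) (v : 'cV[R]_n) (l : 'I_n) :
  `|v l 0| <= euclidean_norm v.
Proof.
rewrite -sqrtr_sqr; apply: ler_wsqrtr.
by rewrite (bigD1 l) //= lerDl sumr_ge0 // => k _; exact: sqr_ge0.
Qed.

(** A deceiver [z l] of [i] differs from [i], so row [z l] of [Q_i] is nonzero only in column
    [i]. *)
Lemma calQbarE (R : realType) (N : nat) (r : 'I_N -> R) (Sd : R)
    (m : 'I_N -> R) (n : nat) (z : 'I_n -> 'I_N) (D : 'I_N -> {set 'I_N})
    (hDz : forall l, z l \notin D (z l)) (delta : 'cV[R]_n) (i j : 'I_N) :
  calQbar r Sd m z D delta i j = Rpar r / r i *
    (if j == i then 2 * (\sum_(k | k != i) (r k)^-1) -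
       \sum_(l | z l \in deceivers z D i) delta l 0 / r (z l)
     else - (r j)^-1).
Proof.
have zi l : i \in D (z l) -> z l != i by apply: contraTneq => <-.
rewrite mxE mxE summxE.
have -> : \sum_(l | z l \in deceivers z D i)
      (delta l 0 *: row (z l) (Qmat r Sd m i)) 0 j =
    - (Rpar r / r i *
      if j == i then \sum_(l | z l \in deceivers z D i) delta l 0 / r (z l)
      else 0).
  have [->|ji] := eqVneq j i; last first.
    rewrite mulr0 oppr0 big1 // => l; rewrite inE => /andP[_ iD].
    by rewrite /Qmat hessian_cost !mxE (negPf ji) andbF orbF
      (negPf (zi l iD)) mulr0.
  rewrite mulr_sumr -sumrN; apply: eq_bigr => l; rewrite inE => /andP[_ iD].
  by rewrite /Qmat hessian_cost !mxE (negPf (zi l iD)) eqxx /= invfM; ring.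
rewrite 3!mxE /Qmat hessian_cost mxE eqxx /=.
by case: eqP => ji; rewrite invfM ?invrK; ring.
Qed.

(** Each coordinate of [delta] is at most its norm, and the deceivers of [i] are distinct players
    other than [i]; this bounds the left side by [euclidean_norm delta * S]. Strictness comes from
    [S > 0], as [N >= 2]. *)
Lemma deception_lt (R : realType) (N : nat) (hN : (2 <= N)%N)
    (r : 'I_N -> R) (hr : forall i, 0 < r i) (n : nat) (z : 'I_n -> 'I_N)
    (hz : injective z) (D : 'I_N -> {set 'I_N})
    (hDz : forall l, z l \notin D (z l)) (delta : 'cV[R]_n) (i : 'I_N) :
  euclidean_norm delta < 1 ->
  \sum_(l | z l \in deceivers z D i) delta l 0 / r (z l) <
  \sum_(k | k != i) (r k)^-1.
Proof.
move=> delta1; set S := (X in _ < X).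
have S_gt0 : 0 < S.
  have /card_gt0P[k ki] : (0 < #|predC1 i|)%N.
    by rewrite cardC1 card_ord -ltnS prednK // ltnW.
  rewrite /S (bigD1 k) //= ltr_wpDr ?invr_gt0 // sumr_ge0 // => j _.
  by rewrite invr_ge0 ltW.
apply: le_lt_trans (_ : euclidean_norm delta * S < S); last first.
  by rewrite gtr_pMl.
(* The sum is enlarged to all deceptive players other than [i]. *)
apply: le_trans (_ : \sum_(l | z l != i) euclidean_norm delta / r (z l) <= _).
  rewrite [leRHS](bigID (fun l => z l \in deceivers z D i)) /=.
  rewrite ler_wpDr ?sumr_ge0 // => [l _|].
    by rewrite divr_ge0 ?sqrtr_ge0 // ltW.
  rewrite [leRHS](eq_bigl (fun l => z l \in deceivers z D i)) => [|l].
    apply: ler_sum => l _; rewrite ler_wpM2r ?invr_ge0 ?(ltW (hr _)) //.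
    exact: le_trans (ler_norm _) (norm_le_euclidean _ _).
  rewrite inE; case: (eqVneq (z l) i) => [<-|//].
  by rewrite (negPf (hDz l)) andbF.
rewrite -mulr_sumr ler_wpM2l ?sqrtr_ge0 //.
(* Injectivity of [z] turns the sum over indices into one over a subset of the players [k != i]. *)
rewrite -(big_imset (fun k => (r k)^-1) (A := [pred l | z l != i]));
  last by move=> x y _ _ /hz.
rewrite /S [leRHS](bigID (mem [set z l | l in [pred l | z l != i]])) /=.
rewrite [X in _ <= X + _](eq_bigl (mem [set z l | l in [pred l | z l != i]])).
  by rewrite lerDl sumr_ge0 // => k _; rewrite invr_ge0 ltW.
move=> k /=; apply/andb_idl => /imsetP[l li ->]; exact: li.
Qed.

Theorem lemma1 (R : realType) (N : nat) (hN : (2 <= N)%N)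
    (r : 'I_N -> R) (hr : forall i, 0 < r i) (Sd : R) (m : 'I_N -> R)
    (n : nat) (z : 'I_n -> 'I_N) (hz : injective z)
    (D : 'I_N -> {set 'I_N})
    (hD0 : forall l, D (z l) != set0) (hDz : forall l, z l \notin D (z l))
    (kappa : 'I_N -> R) (hkappa : forall i, 0 < kappa i)
    (delta : 'cV[R]_n) :
  euclidean_norm delta < 1 -> Delta r Sd m z D kappa delta.
Proof.
move=> delta1; apply: hurwitz_diag_dominant => i.
(* The positive factor common to all entries of row [i] of [K Qbar]. *)
pose c := kappa i * (Rpar r / r i).
have c_gt0 : 0 < c.
  rewrite mulr_gt0 ?divr_gt0 // invr_gt0 (bigD1 i) //=.
  by rewrite ltr_wpDr ?invr_gt0 // sumr_ge0 // => k _; rewrite invr_ge0 ltW.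
have AE j : (- (diag_mx (\row_k kappa k) *m calQbar r Sd m z D delta)) i j =
    - (kappa i * calQbar r Sd m z D delta i j).
  by rewrite mul_diag_mx !mxE.
rewrite AE calQbarE // eqxx mulrA opprK -/c.
rewrite (eq_bigr (fun j => c * (r j)^-1)) => [|j /negPf ji]; last first.
  rewrite AE calQbarE // ji mulrA -/c mulrN opprK ger0_norm //.
  by rewrite mulr_ge0 ?invr_ge0 // ltW.
(* With [c] cancelled, dominance reads [S < 2 S - T], where [S] sums [(r k)^-1] over [k != i] and
   [T] is the deception term; that is, [T < S]. *)
rewrite -mulr_sumr ltr_pM2l // mulr_natl mulr2n -addrA ltrDl subr_gt0.
exact: deception_lt.
Qed.
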